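(* Let $(X,d,\mu)$ be a coarse median space and $n\in\mathbb N$. The following are equivalent: (1) $X$ has rank at most $n$; (2) for every $\lambda>0$ there is a constant $C=C(\lambda)$ such that for all $a,b\in X$ and all $e_1,\ldots,e_{n+1}\in[a,b]$ with $\mu(e_i,a,e_j)\sim_\lambda a$ for all $i\neq j$, there exists $i$ with $e_i\sim_C a$; (3) for every $L>0$ there is a constant $C=C(L)$ such that for every $L$-quasi-morphism $\sigma\colon I^{n+1}\to X$ there exist adjacent points $x,y\in I^{n+1}$ with $\sigma(x)\sim_C\sigma(y)$.
   Context: Write $x\sim_s y$ if $d(x,y)\leqslant s$. A coarse median space is a triple $(X,d,\mu)$ with $(X,d)$ a metric space and $\mu\colon X^3\to X$ satisfying: (M1) $\mu(a,a,b)=a$; (M2) $\mu(a_1,a_2,a_3)$ is invariant under permutations of its arguments; (C1) there is an affine $\rho(t)=Kt+H_0$ with $d(\mu(a,b,c),\mu(a',b',c'))\leqslant\rho(d(a,a')+d(b,b')+d(c,c'))$ for all points; (C2) there is $H\colon\mathbb N\to[0,\infty)$ such that for every finite $A\subseteq X$ with $1\leqslant|A|\leqslant p$ there are a finite median algebra $(\Pi,\mu_\Pi)$ and maps $\pi\colon A\to\Pi$, $\lambda\colon\Pi\to X$ with $\lambda\mu_\Pi(x,y,z)\sim_{H(p)}\mu(\lambda x,\lambda y,\lambda z)$ for all $x,y,z\in\Pi$ and $\lambda\pi a\sim_{H(p)}a$ for all $a\in A$. (A median algebra is a set with a ternary operation $m$ satisfying $m(a,a,b)=a$, full symmetry, and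 $m(m(a,b,c),b,d)=m(a,b,m(c,b,d))$.) The median cube $I^k$ is $(\mathbb Z_2)^k$ with median $\mu_k$ given by coordinatewise majority vote; two points of $I^k$ are adjacent if they differ in exactly one coordinate. The rank of a median algebra is the supremum of $k$ such that it contains a subalgebra isomorphic to $I^k$. The coarse median space has rank at most $n$ if there exist $\rho,H$ as in (C1),(C2) for which $\Pi$ in (C2) can always be chosen of rank at most $n$. The interval is $[a,b]=\{\mu(a,y,b):y\in X\}$. A map $\sigma\colon I^k\to X$ is an $L$-quasi-morphism if $\mu(\sigma x,\sigma y,\sigma z)\sim_L\sigma(\mu_k(x,y,z))$ for all $x,y,z\in I^k$. *)

(* Defs.v *)
From Stdlib Require Import Reals List.
From mathcomp Require Import all_boot.

Set Implicit Arguments.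
Unset Strict Implicit.
Unset Printing Implicit Defensive.

Open Scope R_scope.

Section CoarseMedian.
Variable X : Type.
Variable d : X -> X -> R.
Variable mu : X -> X -> X -> X.

Definition close (s : R) (x y : X) : Prop := d x y <= s.

Definition is_metric : Prop :=
  (forall x y, 0 <= d x y) /\ (forall x, d x x = 0) /\
  (forall x y, d x y = 0 -> x = y) /\ (forall x y, d x y = d y x) /\
  (forall x y z, d x z <= d x y + d y z).

Definition M1 : Prop := forall a b, mu a a b = a.
Definition M2 : Prop := forall a b c,
  mu a b c = mu b a c /\ mu a b c = mu a c b /\ mu a b c = mu b c a /\
  mu a b c = mu c a b /\ mu a b c = mu c b a.
Definition C1 (K H0 : R) : Prop := forall a b c a' b' c',
  d (mu a b c) (mu a' b' c') <= K * (d a a' + d b b' + d c c') + H0.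
End CoarseMedian.

Definition median_algebra (T : Type) (m : T -> T -> T -> T) : Prop :=
  (forall a b, m a a b = a) /\
  (forall a b c,
     m a b c = m b a c /\ m a b c = m a c b /\ m a b c = m b c a /\
     m a b c = m c a b /\ m a b c = m c b a) /\
  (forall a b c e, m (m a b c) b e = m a b (m c b e)).

Definition cube (k : nat) := {ffun 'I_k -> bool}.
Definition maj (a b c : bool) : bool := [|| a && b, b && c | a && c].
Definition mu_cube (k : nat) (x y z : cube k) : cube k :=
  [ffun i => maj (x i) (y i) (z i)].
Definition adjacent (k : nat) (x y : cube k) : Prop :=
  #|[set i | x i != y i]| = 1%N.

(* A median algebra contains a subalgebra isomorphic to I^k iff there is an
   injective median homomorphism I^k -> Pi (its image is such a subalgebra). *)
Definition contains_cube (T : Type) (m : T -> T -> T -> T) (k : nat) : Prop :=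
  exists f : cube k -> T, injective f /\
    forall x y z, f (mu_cube x y z) = m (f x) (f y) (f z).

Definition median_rank_le (T : Type) (m : T -> T -> T -> T) (n : nat) : Prop :=
  forall k, contains_cube m k -> (k <= n)%N.

Section CoarseMedian2.
Variable X : Type.
Variable d : X -> X -> R.
Variable mu : X -> X -> X -> X.

(* (C2) with function H, and Pi restricted by predicate rankP.
   Finite subsets A with 1 <= |A| <= p are given as nonempty lists of
   length <= p. *)
Definition C2_with (H : nat -> R)
    (rankP : forall (P : finType), (P -> P -> P -> P) -> Prop) : Prop :=
  forall (p : nat) (A : list X), (1 <= length A)%coq_nat -> (length A <= p)%coq_nat ->
    exists (P : finType) (m : P -> P -> P -> P),
      median_algebra m /\ rankP P m /\
      exists (pi : X -> P) (lam : P -> X),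
        (forall x y z : P, close d (H p) (lam (m x y z)) (mu (lam x) (lam y) (lam z))) /\
        (forall a, In a A -> close d (H p) (lam (pi a)) a).

Definition coarse_median_space : Prop :=
  is_metric d /\ M1 mu /\ M2 mu /\
  (exists K H0, C1 d mu K H0) /\
  (exists H : nat -> R, C2_with H (fun _ _ => True)).

Definition rank_at_most (n : nat) : Prop :=
  exists K H0 (H : nat -> R),
    C1 d mu K H0 /\ C2_with H (fun P m => median_rank_le m n).

Definition in_interval (a b e : X) : Prop := exists y, e = mu a y b.

Definition quasi_morphism (L : R) (k : nat) (sigma : cube k -> X) : Prop :=
  forall x y z, close d L (mu (sigma x) (sigma y) (sigma z)) (sigma (mu_cube x y z)).
End CoarseMedian2.

(* Main.v *)
(* Homomorphisms to {0,1} ("walls") separate the points of a finite median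
   algebra: if z is an atom over x in the interval [x,y], the projection to
   [x,z] = {x,z} is one.  So median identities can be checked on booleans.

   (1) => (2) and (3) => (2): approximate a, b, e_i in a finite median algebra
   by a', b', e'_i; the join o of the meets of distinct e'_i stays close to a',
   and S |-> o joined with the e'_i, i in S, is a homomorphism from a cube.
   Under (1) it is not injective, under (3) it has a short edge; either way
   some edge at the vertex o is short.

   (2) => (3): use the neighbours of the vertex 0 of the cube.

   (3) => (1): an approximation of p points may be taken inside a cube whose
   dimension k depends only on p.  If its rank exceeds n, (3) provides two
   distinct points with close images; then points differing in just one
   coordinate, where those two differ, have close images, and this coordinate
   can be dropped.  After at most k steps the rank is at most n. *)

Require Import Defs.
From Stdlib Require Import Reals List Lra Classical IndefiniteDescription.
From mathcomp Require Import all_boot.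
Open Scope R_scope.

Set Implicit Arguments.
Unset Strict Implicit.
Unset Printing Implicit Defensive.

(** * Walls of finite median algebras *)

Definition wall (P : Type) (m : P -> P -> P -> P) (h : P -> bool) : Prop :=
  forall x y z, h (m x y z) = maj (h x) (h y) (h z).

Section Walls.
Variables (P : finType) (m : P -> P -> P -> P).
Hypothesis medP : median_algebra m.

Lemma medxx a b : m a a b = a. Proof. by case: medP. Qed.

Lemma medC a b c : m a b c = m b a c.
Proof. by case: medP => _ [/(_ a b c)[]]. Qed.

Lemma medAC a b c : m a b c = m a c b.
Proof. by case: medP => _ [/(_ a b c)[_ []]]. Qed.

Lemma medA a b c e : m (m a b c) b e = m a b (m c b e).
Proof. by case: medP => _ []. Qed.

Lemma medxyx a b : m a b a = a.
Proof. by rewrite medAC medxx. Qed.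

Lemma medyxx a b : m b a a = a.
Proof. by rewrite medC medxyx. Qed.

Lemma med_idem a b u : m a b (m a b u) = m a b u.
Proof. by rewrite -medA medxyx. Qed.


Lemma medCA a b c : m a b c = m c b a.
Proof. by case: medP => _ [/(_ a b c)[_ [_ [_ []]]]]. Qed.

(* Halfspace convexity below rests on this: [m a b x] is the gate of [x] in the
   interval from [a] to [b]. *)
Lemma med_gate x a b c : m (m a b x) x (m a b c) = m a b x.
Proof.
set g := m a b x; set w := m a b c.
have abw : m a b w = w by exact: med_idem.
have abg : m a b g = g by exact: med_idem.
(* As [w] lies between [a] and [b], replacing [x] by its gate [g] does not change the median with
   [b] and [w]. *)
have xbw : m x b w = m g b w by rewrite -{1}abw -medA (medCA x).
have abt : m (m g b w) b a = m g b w by rewrite medA (medCA w) abw.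
have gax : g = m a x b by rewrite medAC.
rewrite {1}gax medA (medC b x) xbw -abt (medCA _ b a) (medC a b) (medC a x) -medA.
rewrite (medCA x a b) (medC b a) -/g (medC g a) (medC g b) -medA.
by rewrite (medAC a g) abg medxx.
Qed.

(** The two hypotheses put the gate [m a b x] in the halfspace. By [med_gate] this gate lies between
    [x] and [m a b c], so associativity carries membership on to [m a b c]. *)
Lemma halfspace_convex x y a b c :
  m x y a = y -> m x y b = y -> m x y (m a b c) = y.
Proof.
move=> ha hb.
have hg : m y x (m a b x) = y.
  by rewrite (medAC a) -medA (medC y) ha (medC y).
by rewrite (medC x) -{1}hg medA med_gate.
Qed.

(** The atom is a point [z] other than [x] in the interval from [x] to [y], chosen so that the
    interval from [x] to [z] has as few points as possible. *)
Lemma walls_separate x y : x <> y -> exists h, wall m h /\ h x <> h y.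
Proof.
move/eqP=> neq_xy.
have Py : (y != x) && (m x y y == y) by rewrite eq_sym neq_xy medyxx eqxx.
case: (@arg_minnP _ y [pred z | (z != x) && (m x z y == z)]
  (fun z => #|[set t | m x t z == t]|) Py) => z /andP[neq_zx /eqP xzy] min_z.
(* If [v] is not [x], it competes with [z], and its interval from [x] is contained in that of [z].
   Minimality makes the two equal, so [z] lies between [x] and [v], which forces [v = z]. *)
have atom u : m x z u <> x -> m x z u = z.
  move/eqP=> ux; set v := m x z u.
  have vE : m x v z = v by rewrite medAC med_idem.
  have vux : v = m u x z by rewrite /v medAC (medC x).
  have vy : m x v y = v by rewrite (medC x) vux medA (medC z) xzy.
  have sub : [set t | m x t v == t] \subset [set t | m x t z == t].
    apply/subsetP => t; rewrite !inE => /eqP tv.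
    by rewrite (medC x) -tv (medC x) medA (medC v) vE (medC t).
  have /eqP /setP/(_ z) : [set t | m x t v == t] == [set t | m x t z == t].
    by rewrite eqEcard sub min_z //= ux vy eqxx.
  by rewrite !inE medyxx eqxx med_idem => /eqP.
have low u : m x z u <> z -> m z x u = x.
  by move=> uz; rewrite medC; apply: NNPP => /atom.
exists (fun u => m x z u == z); split; last first.
  by rewrite medxyx xzy eqxx eq_sym (negbTE neq_zx).
move=> a b c.
(* The two sides are halfspaces of the same form with [x] and [z] exchanged. Two of the three
   arguments share a side, and convexity puts the median there. *)
have high := @halfspace_convex x z; have lowc := @halfspace_convex z x.
have not_high u : m z x u = x -> (m x z u == z) = false.
  by rewrite medC => ->; rewrite eq_sym (negbTE neq_zx).
case: (m x z a =P z) => [ha|/low ha]; case: (m x z b =P z) => [hb|/low hb];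
  case: (m x z c =P z) => [hc|/low hc];
  rewrite /maj /=; first [apply: not_high | apply/eqP]; 
  by [apply: high | apply: lowc | rewrite (medAC a); apply: high
     | rewrite (medAC a); apply: lowc | rewrite (medCA a); apply: high
     | rewrite (medCA a); apply: lowc].
Qed.

Lemma wall_ext x y : (forall h, wall m h -> h x = h y) -> x = y.
Proof.
move=> hxy; apply: NNPP => /walls_separate[h [hm]]; apply; exact: hxy.
Qed.

End Walls.

(** * Cubes spanned by points of an interval *)

Lemma cube_neq (k : nat) (x y : cube k) : x <> y -> exists i, x i != y i.
Proof.
move=> xy; apply: NNPP => noi; apply: xy; apply/ffunP => i; apply/eqP.
by apply: contraT => xyi; case: noi; exists i.
Qed.

Lemma adjacent_neq (k : nat) (x y : cube k) : adjacent x y -> x <> y.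
Proof.
move=> + xy; rewrite /adjacent xy; suff -> : [set i | y i != y i] = set0.
  by rewrite cards0.
by apply/setP => i; rewrite !inE eqxx.
Qed.

Definition cube_hom (P : Type) (m : P -> P -> P -> P) (k : nat) (f : cube k -> P) : Prop :=
  forall x y z, f (mu_cube x y z) = m (f x) (f y) (f z).

Definition zero_vertex (k : nat) : cube k := [ffun=> false].
Definition unit_vertex (k : nat) (i : 'I_k) : cube k := [ffun j => i == j].

Section Spanned.
Variables (P : finType) (m : P -> P -> P -> P) (N : nat) (a b : P) (e : 'I_N -> P).
Hypothesis medP : median_algebra m.

(** In the interval from [a] to [b], ordered with bottom [a] and top [b], the join of [x] and [y] is
    [m x b y] and their meet is [m x a y]. *)
Definition fold_join (I : Type) (c : I -> P) (u : P) (s : seq I) : P :=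
  foldr (fun i v => m (c i) b v) u s.

Definition meets_join : P :=
  fold_join (fun p : 'I_N * 'I_N => m (e p.1) a (e p.2)) a
    [seq p <- enum {: 'I_N * 'I_N} | p.1 != p.2].

Definition spanned (S : cube N) : P :=
  fold_join e meets_join [seq i <- enum 'I_N | S i].

Section AtWall.
Variables (h : P -> bool).
Hypothesis hm : wall m h.

(** Relative to the side of [b], joins become disjunctions whichever boolean [h b] is; nothing is
    lost, since majority commutes with negation. *)
Let above u := h u == h b.

Lemma above_fold_join (I : Type) (c : I -> P) u s :
  above (fold_join c u s) = has (fun i => above (c i)) s || above u.
Proof.
elim: s => //= i s IHs; rewrite -orbA -{}IHs /above hm.
by case: (h b); case: (h (c i)); case: (h _).
Qed.

Lemma above_spanned S :
  above (spanned S) = [exists i, S i && above (e i)] || above meets_join.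
Proof.
rewrite above_fold_join -/above; congr (_ || _); apply/hasP/existsP.
  by case=> i; rewrite mem_filter => /andP[Si _] ?; exists i; rewrite Si.
by case=> i /andP[Si ?]; exists i => //; rewrite mem_filter Si mem_enum.
Qed.

Lemma above_meets_join i j :
  i != j -> above (e i) -> above (e j) -> above meets_join.
Proof.
move=> ij /eqP hi /eqP hj; rewrite above_fold_join; apply/orP; left.
apply/hasP; exists (i, j); first by rewrite mem_filter ij mem_enum.
by rewrite /above hm /= hi hj /maj; case: (h b); case: (h a).
Qed.

(** If [meets_join] is above, every [spanned S] is. Otherwise at most one [e i] is above, since two
    would put their meet above; then [spanned S] is above exactly when [S i], or never if there is
    no such [i]. *)
Lemma wall_spanned x y z :
  h (spanned (mu_cube x y z)) = maj (h (spanned x)) (h (spanned y)) (h (spanned z)).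
Proof.
suff: above (spanned (mu_cube x y z)) =
    maj (above (spanned x)) (above (spanned y)) (above (spanned z)).
  rewrite /above; case: (h (spanned (mu_cube x y z))); case: (h (spanned x));
  by case: (h (spanned y)); case: (h (spanned z)); case: (h b).
rewrite !above_spanned; case: (boolP (above meets_join)) => [|nb].
  by rewrite !orbT.
rewrite !orbF; case: (pickP (fun i => above (e i))) => [i hi|no]; last first.
  have E S : [exists i, S i && above (e i)] = false.
    by apply/existsP => -[i]; rewrite no andbF.
  by rewrite !E.
have E S : [exists i, S i && above (e i)] = S i.
  apply/existsP/idP => [[j /andP[Sj hj]]|Si]; last by exists i; rewrite Si hi.
  case: (eqVneq i j) => [->//|ij].
  by case/negP: nb; apply: above_meets_join hi hj.
by rewrite !E ffunE.
Qed.

End AtWall.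

Lemma spanned_hom : cube_hom m spanned.
Proof.
by move=> x y z; apply: (wall_ext medP) => h hm; rewrite hm wall_spanned.
Qed.

Lemma spanned_zero : spanned (zero_vertex N) = meets_join.
Proof.
rewrite /spanned (eq_filter (a2 := pred0)) ?filter_pred0 // => i.
by rewrite ffunE.
Qed.

Lemma spanned_unit i : spanned (unit_vertex i) = m (e i) b meets_join.
Proof.
rewrite /spanned (eq_filter (a2 := pred1 i)) => [|j]; last by rewrite ffunE eq_sym.
by rewrite filter_pred1_uniq ?enum_uniq ?mem_enum.
Qed.

End Spanned.

(** * Median algebras inside cubes *)

Lemma cube_model_median (T : Type) (k : nat) (m : T -> T -> T -> T) (c : T -> cube k) :
  injective c -> (forall x y z, c (m x y z) = mu_cube (c x) (c y) (c z)) ->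
  median_algebra m.
Proof.
move=> c_inj cM; split=> [u v|]; last split=> [u v w|u v w t]; last 1 first.
- apply: c_inj; rewrite !cM; apply/ffunP => i; rewrite !ffunE.
  by case: (c u i); case: (c v i); case: (c w i); case: (c t i).
- by apply: c_inj; rewrite !cM; apply/ffunP => i; rewrite !ffunE;
    case: (c u i); case: (c v i).
- by do !split; apply: c_inj; rewrite !cM; apply/ffunP => i; rewrite !ffunE;
    case: (c u i); case: (c v i); case: (c w i).
Qed.

Lemma contains_cube_le (T : Type) (m : T -> T -> T -> T) (j k : nat) :
  (j <= k)%N -> contains_cube m k -> contains_cube m j.
Proof.
move=> le_jk [f [f_inj fM]].
pose ext (x : cube j) : cube k :=
  [ffun i : 'I_k => if insub (val i) is Some i' then x i' else false].
exists (f \o ext); split=> [x y /f_inj /ffunP xy|x y z] /=.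
  apply/ffunP => i; have := xy (widen_ord le_jk i).
  by rewrite !ffunE /= valK.
rewrite -fM; congr f; apply/ffunP => i; rewrite !ffunE.
by case: insubP => [i' _ _|_]; rewrite ?ffunE.
Qed.

(** A wall is recorded only by its pattern of values on the [q] points [v i], so one coordinate per
    pattern suffices and the dimension is independent of [P]. *)
Lemma cube_model_of_points (P : finType) (m : P -> P -> P -> P) (q : nat)
    (v : 'I_q -> P) :
  median_algebra m ->
  exists (T : finType) (mT : T -> T -> T -> T) (c : T -> cube #|{: cube q}|)
    (g : T -> P) (t : 'I_q -> T),
    injective c /\ (forall x y z, c (mT x y z) = mu_cube (c x) (c y) (c z)) /\
    (forall x y z, g (mT x y z) = m (g x) (g y) (g z)) /\
    (forall i, g (t i) = v i).
Proof.
move=> medP.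
pose value (h : P -> bool) : 'I_#|{: cube q}| := enum_rank [ffun i => h (v i)].
pose wallb (h : {ffun P -> bool}) :=
  [forall x, forall y, forall z, h (m x y z) == maj (h x) (h y) (h z)].
have wallbP (h : {ffun P -> bool}) : reflect (wall m h) (wallb h).
  apply: (iffP idP) => [H x y z|H].
    by move/forallP/(_ x)/forallP/(_ y)/forallP/(_ z)/eqP: H.
  by apply/forallP => x; apply/forallP => y; apply/forallP => z; apply/eqP.
(* A coordinate whose pattern comes from no wall is unconstrained, so several [p] may match one [g];
   conversely [p] determines [g], by [wall_ext]. *)
pose match_ (p : cube #|{: cube q}|) (g : P) :=
  [forall h : {ffun P -> bool}, wallb h ==> (h g == p (value h))].
have matchP (p : cube #|{: cube q}|) g : reflect (forall h, wall m h -> h g = p (value h)) (match_ p g).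
  apply: (iffP forallP) => [H h hm|H h]; last first.
    by apply/implyP => /wallbP hm; apply/eqP/H.
  pose h' := [ffun x => h x].
  have hm' : wall m h' by move=> x y z; rewrite !ffunE.
  have <- : value h' = value h.
    by congr enum_rank; apply/ffunP => i; rewrite !ffunE.
  by have := H h'; rewrite (introT (wallbP _) hm') /= ffunE => /eqP.
pose T := {p : cube #|{: cube q}| | [exists g, match_ p g]}.
have exg (x : T) : exists g, match_ (val x) g by apply/existsP: (valP x).
pose g (x : T) : P := xchoose (exg x).
have gP (x : T) h : wall m h -> h (g x) = val x (value h).
  by apply/matchP; exact: (xchooseP (exg x)).
have mT_mem (x y z : T) :
    [exists u, match_ (mu_cube (val x) (val y) (val z)) u].
  apply/existsP; exists (m (g x) (g y) (g z)); apply/matchP => h hm.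
  by rewrite hm !gP // ffunE.
pose proj i : cube #|{: cube q}| := [ffun j => (enum_val j : cube q) i].
have projP i h : h (v i) = proj i (value h).
  by rewrite /proj ffunE /value enum_rankK ffunE.
have t_mem i : [exists u, match_ (proj i) u].
  by apply/existsP; exists (v i); apply/matchP.
exists T, (fun x y z => Sub (mu_cube (val x) (val y) (val z)) (mT_mem x y z)), val, g,
  (fun i => Sub (proj i) (t_mem i)).
split; first exact: val_inj.
split=> //; split=> [x y z|i]; apply: (wall_ext medP) => h hm.
  by rewrite hm !gP //= ffunE.
by rewrite gP.
Qed.

(** * Coarse estimates and cubes over intervals *)

Section Coarse.
Variables (X : Type) (d : X -> X -> R) (mu : X -> X -> X -> X).
Hypothesis metric_d : is_metric d.

Lemma dist_ge0 x y : 0 <= d x y. Proof. by case: metric_d. Qed.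

Lemma dist_refl x : d x x = 0. Proof. by case: metric_d => _ []. Qed.

Lemma dist_sym x y : d x y = d y x.
Proof. by case: metric_d => _ [_ [_ []]]. Qed.

Lemma dist_triangle x y z : d x z <= d x y + d y z.
Proof. by case: metric_d => _ [_ [_ [_]]]. Qed.

Lemma C1_nonneg K H0 : Defs.C1 d mu K H0 -> exists K' H', 0 <= K' /\ 0 <= H' /\ Defs.C1 d mu K' H'.
Proof.
move=> hC; exists (Rabs K), (Rabs H0); split; first exact: Rabs_pos.
split; first exact: Rabs_pos.
move=> a b c a' b' c'; apply: Rle_trans (hC a b c a' b' c') _.
apply: Rplus_le_compat; last exact: Rle_abs.
apply: Rmult_le_compat_r; last exact: Rle_abs.
by have := dist_ge0 a a'; have := dist_ge0 b b'; have := dist_ge0 c c'; lra.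
Qed.

Variables (K H0 : R).
Hypotheses (K_ge0 : 0 <= K) (mu_C1 : Defs.C1 d mu K H0).

Lemma mu_close s1 s2 s3 a b c a' b' c' :
  d a a' <= s1 -> d b b' <= s2 -> d c c' <= s3 ->
  d (mu a b c) (mu a' b' c') <= K * (s1 + s2 + s3) + H0.
Proof.
move=> h1 h2 h3; apply: Rle_trans (mu_C1 a b c a' b' c') _.
by apply: Rplus_le_compat_r; apply: Rmult_le_compat_l => //; lra.
Qed.

Lemma mu_closeL L s1 s2 s3 u a b c a' b' c' :
  d u (mu a b c) <= L -> d a a' <= s1 -> d b b' <= s2 -> d c c' <= s3 ->
  d u (mu a' b' c') <= L + (K * (s1 + s2 + s3) + H0).
Proof.
move=> hu h1 h2 h3.
by have := mu_close h1 h2 h3; have := dist_triangle u (mu a b c) (mu a' b' c'); lra.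
Qed.

Definition quasi_hom (L : R) (P : Type) (m : P -> P -> P -> P) (lam : P -> X) : Prop :=
  forall x y z, d (lam (m x y z)) (mu (lam x) (lam y) (lam z)) <= L.

Hypotheses (mu_M1 : M1 mu) (mu_M2 : M2 mu).

Lemma muxyx a b : mu a b a = a.
Proof. by case: (mu_M2 a b a) => _ [-> _]. Qed.

(** A join of two points near [x] is near [mu x (lam b) x = x], wherever [b] is. The bound [s'] is
    fixed before the algebra, so it serves all approximations at once. *)
Lemma fold_join_close (I : eqType) (L s : R) (r : seq I) :
  exists s', forall (P : finType) (m : P -> P -> P -> P) (lam : P -> X) (b u : P)
      (c : I -> P) (x : X),
    quasi_hom L m lam -> d (lam u) x <= s ->
    (forall i, i \in r -> d (lam (c i)) x <= s) ->
    d (lam (fold_join m b c u r)) x <= s'.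
Proof.
elim: r => [|i r [s' IHr]]; first by exists s.
exists (L + (K * (s + 0 + s') + H0)) => P m lam b u c x qlam ux cx /=.
rewrite -(muxyx x (lam b)).
apply: mu_closeL (qlam _ _ _) _ _ _.
- by apply: cx; rewrite mem_head.
- by rewrite dist_refl; lra.
- by apply: IHr => // j jr; apply: cx; rewrite inE jr orbT.
Qed.

(* A short edge transports along its parallelism class to an edge at the
   zero vertex. *)
Lemma short_edge_at_zero (C L : R) (N : nat) (sigma : cube N -> X) (x y : cube N)
    (i : 'I_N) :
  quasi_hom L (@mu_cube N) sigma -> x i != y i -> d (sigma x) (sigma y) <= C ->
  d (sigma (unit_vertex i)) (sigma (zero_vertex N)) <= L + (K * (0 + C + 0) + H0) + L.
Proof.
move=> qs; wlog xi : x y / x i = true => [wl xy|].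
  case: (boolP (x i)) => [xi|nxi]; first exact: wl.
  rewrite dist_sym; apply: wl; last by rewrite eq_sym.
  by move: xy; rewrite (negbTE nxi); case: (y i).
rewrite xi => yi hxy.
set o := zero_vertex N; set u := unit_vertex i.
(* Off coordinate [i], [o] and [u] agree; at [i] they differ, so there the third point decides the
   majority. *)
have ux : u = mu_cube o x u.
  apply/ffunP => j; rewrite !ffunE; case: eqP => [<-|_]; first by rewrite xi.
  by case: (x j).
have oy : o = mu_cube o y u.
  apply/ffunP => j; rewrite !ffunE; case: eqP => [<-|_]; last by case: (y j).
  by move: yi; case: (y i).
have h1 : d (sigma u) (mu (sigma o) (sigma y) (sigma u)) <= L + (K * (0 + C + 0) + H0).
  rewrite {1}ux; apply: mu_closeL (qs _ _ _) _ hxy _; by rewrite dist_refl; lra.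
have h2 := qs o y u; rewrite -oy dist_sym in h2.
by have := dist_triangle (sigma u) (mu (sigma o) (sigma y) (sigma u)) (sigma o); lra.
Qed.

Lemma quasi_morphism_of_hom (L : R) (P : Type) (m : P -> P -> P -> P) (lam : P -> X)
    (N : nat) (f : cube N -> P) :
  quasi_hom L m lam -> cube_hom m f -> quasi_hom L (@mu_cube N) (lam \o f).
Proof. by move=> ql fM x y z; rewrite /= fM. Qed.

Lemma size_length (T : Type) (s : list T) : length s = size s.
Proof. by []. Qed.

Lemma mem_In_map (I : eqType) (T : Type) (f : I -> T) (s : seq I) i :
  i \in s -> In (f i) (map f s).
Proof.
elim: s => //= j s IHs; rewrite inE => /orP[/eqP ->|/IHs]; first by left.
by right.
Qed.

Lemma interval_cube (N : nat) (H : nat -> R)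
    (rankP : forall P : finType, (P -> P -> P -> P) -> Prop) (s0 : R) :
  C2_with d mu H rankP ->
  exists s, forall (a b : X) (e : 'I_N -> X),
    (forall i, in_interval mu a b (e i)) ->
    (forall i j, i <> j -> d (mu (e i) a (e j)) a <= s0) ->
    exists (P : finType) (m : P -> P -> P -> P) (lam : P -> X) (f : cube N -> P),
      rankP P m /\ quasi_hom (H N.+2) m lam /\ cube_hom m f /\
      d (lam (f (zero_vertex N))) a <= s /\
      forall i, d (lam (f (unit_vertex i))) (e i) <= s.
Proof.
move=> hC2; set L := H N.+2.
(* In turn: [s1] compares [e' i] with [e i], [s2] their pairwise meets with [a], [s3] the join of
   these meets with [a], and [s4] the unit vertices with [e i]. *)
pose s1 := L + (K * (L + L + L) + H0).
pose s2 := L + (K * (s1 + L + s1) + H0) + s0.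
have [s3 hs3] := fold_join_close L (Rmax L s2)
  [seq p <- enum {: 'I_N * 'I_N} | p.1 != p.2].
pose s4 := L + (K * (0 + 0 + (s3 + L)) + H0) + L + s1.
exists (Rmax s3 s4) => a b e.
move=> /functional_choice[y ey] emeet.
(* Approximating the [y i] instead of the [e i] makes each [e' i] lie exactly in the interval from
   [pi a] to [pi b]. *)
pose A := a :: b :: [seq y i | i <- enum 'I_N].
have lenA : length A = N.+2 by rewrite size_length /= size_map size_enum_ord.
have [| |P [m [medP [rkP [pi [lam [qlam lampi]]]]]]] := hC2 N.+2 A.
- by rewrite lenA; apply/leP.
- by rewrite lenA; apply/leP.
rewrite /close -/L in qlam lampi.
have la : d (lam (pi a)) a <= L by apply: lampi; left.
have lb : d (lam (pi b)) b <= L by apply: lampi; right; left.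
have ly i : d (lam (pi (y i))) (y i) <= L.
  by apply: lampi; right; right; apply: mem_In_map; rewrite mem_enum.
pose e' i := m (pi a) (pi (y i)) (pi b).
have le i : d (lam (e' i)) (e i) <= s1.
  by rewrite ey; apply: mu_closeL (qlam _ _ _) _ _ _.
have lbot : d (lam (meets_join m (pi a) (pi b) e')) a <= s3.
  apply: (hs3 P m lam _ _ _ _ qlam) => [|[i j]].
    exact: Rle_trans la (Rmax_l _ _).
  rewrite mem_filter /= => /andP[/eqP ij _]; apply: Rle_trans (Rmax_r _ _).
  have := mu_closeL (qlam (e' i) (pi a) (e' j)) (le i) la (le j).
  have := dist_triangle (lam (m (e' i) (pi a) (e' j))) (mu (e i) a (e j)) a.
  by have := emeet _ _ ij; rewrite /s2; lra.
exists P, m, lam, (spanned m (pi a) (pi b) e').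
split=> //; split=> //; split; first exact: spanned_hom.
rewrite spanned_zero; split=> [|i]; first exact: Rle_trans lbot (Rmax_l _ _).
apply: Rle_trans (Rmax_r _ _); rewrite spanned_unit.
set bot := meets_join _ _ _ _ in lbot *.
(* Joining [e' i] with the bottom [pi a] changes nothing, and [bot] has image close to that of
   [pi a]. *)
have eE : m (e' i) (pi b) (pi a) = e' i.
  apply: (wall_ext medP) => h hm; rewrite /e' !hm.
  by case: (h (pi a)); case: (h (pi b)); case: (h _).
have bota : d (lam bot) (lam (pi a)) <= s3 + L.
  by have := dist_triangle (lam bot) a (lam (pi a)); rewrite (dist_sym a); lra.
have rf u : d u u <= 0 by rewrite dist_refl; lra.
have h1 := mu_closeL (qlam (e' i) (pi b) bot) (rf _) (rf _) bota.
have h2 := qlam (e' i) (pi b) (pi a); rewrite eE dist_sym in h2.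
have := dist_triangle (lam (m (e' i) (pi b) bot))
  (mu (lam (e' i)) (lam (pi b)) (lam (pi a))) (e i).
have := dist_triangle (mu (lam (e' i)) (lam (pi b)) (lam (pi a))) (lam (e' i)) (e i).
by have := le i; rewrite /s4; lra.
Qed.

(** * Lowering the rank of approximations *)

Definition short_edges (n : nat) : Prop :=
  forall L : R, 0 < L -> exists C : R, forall sigma : cube n.+1 -> X,
    quasi_hom L (@mu_cube n.+1) sigma ->
    exists x y, adjacent x y /\ d (sigma x) (sigma y) <= C.

(** Induction on [k], with [L'] chosen before the algebra. Either the rank is already at most [n],
    or an embedded cube of dimension [n.+1] provides a coordinate to drop. *)
Lemma rank_reduction (n k : nat) (L : R) :
  short_edges n ->
  exists L', forall (P : finType) (m : P -> P -> P -> P) (c : P -> cube k) (lam : P -> X),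
    injective c -> (forall x y z, c (m x y z) = mu_cube (c x) (c y) (c z)) ->
    quasi_hom L m lam ->
    exists (P' : finType) (m' : P' -> P' -> P' -> P') (r : P -> P') (lam' : P' -> X),
      median_algebra m' /\ median_rank_le m' n /\ quasi_hom L' m' lam' /\
      forall u, d (lam' (r u)) (lam u) <= L'.
Proof.
move=> se; elim: k L => [|k IHk] L.
  exists (Rmax L 0) => P m c lam c_inj cM qlam; exists P, m, id, lam.
  split; first exact: cube_model_median c_inj cM.
  split=> [[|j]//|].
    case=> f [f_inj _].
    have /f_inj/ffunP/(_ ord0) : f [ffun=> true] = f [ffun=> false].
      by apply: c_inj; apply/ffunP => -[].
    by rewrite !ffunE.
  split=> [x y z|u]; first exact: Rle_trans (qlam _ _ _) (Rmax_l _ _).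
  by rewrite dist_refl; apply: Rmax_r.
have max_gt0 : 0 < Rmax L 1 by apply: Rlt_le_trans (Rmax_r _ _); lra.
have [C hC] := se _ max_gt0.
pose s1 := L + (K * (0 + C + 0) + H0).
pose s2 := L + (K * (0 + 0 + s1) + H0).
pose L1 := (s2 + s2) + L.
have [L2 hL2] := IHk L1.
exists (Rmax (Rmax L 0) (Rmax L2 (L2 + (s2 + s2)))) => P m c lam c_inj cM qlam.
have medP := cube_model_median c_inj cM.
case: (classic (median_rank_le m n)) => [rk|nrk].
  exists P, m, id, lam; split=> //; split=> //.
  split=> [x y z|u]; apply: Rle_trans (Rmax_l _ _).
    exact: Rle_trans (qlam _ _ _) (Rmax_l _ _).
  by rewrite dist_refl; apply: Rmax_r.
have [j nj] := not_all_ex_not _ _ nrk; have [hj /negP] := imply_to_and _ _ nj.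
rewrite -ltnNge => lt_nj.
have [f [f_inj fM]] := contains_cube_le lt_nj hj.
have [|x [y [xy Cxy]]] := hC (lam \o f).
  move=> x y z; apply: Rle_trans (Rmax_l _ _).
  exact: (quasi_morphism_of_hom qlam fM).
have [i hi] : exists i, c (f x) i != c (f y) i.
  by apply: cube_neq => /c_inj/f_inj; apply: adjacent_neq.
pose drop u : cube k := [ffun t => c u (lift i t)].
have dropP u v : drop u = drop v -> forall t, t != i -> c u t = c v t.
  move=> /ffunP uv t; case: (unliftP i t) => [t' ->|->]; last by rewrite eqxx.
  by have := uv t'; rewrite !ffunE.
have rf u : d u u <= 0 by rewrite dist_refl; lra.
have gate u : d (lam (m (f x) (f y) u)) (lam (f x)) <= s1.
  rewrite -{1}(mu_M1 (lam (f x)) (lam u)).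
  apply: mu_closeL (qlam _ _ _) (rf _) _ (rf _).
  by rewrite dist_sym.
have half u v : (forall t, t != i -> c u t = c v t) -> forall w,
    w = u \/ w = v -> d (lam w) (mu (lam u) (lam v) (lam (f x))) <= s2.
  move=> uv w hw.
  (* At [i] the points [f x] and [f y] differ, so the inner median has the value of [w]; off [i],
     [u] and [v] agree. By [gate] the inner median may be replaced by [f x], which gives a centre
     common to [w = u] and [w = v]. *)
  have {1}-> : w = m u v (m (f x) (f y) w).
    apply: c_inj; rewrite !cM; apply/ffunP => t; rewrite !ffunE.
    case: (eqVneq t i) => [->|/uv ti].
      case: hw => ->; move: hi; case: (c (f x) i); case: (c (f y) i) => //;
      by case: (c u i); case: (c v i).
    by case: hw => ->; rewrite ti; case: (c v t).
  exact: mu_closeL (qlam _ _ _) (rf _) (rf _) (gate _).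
have fibre u v : drop u = drop v -> d (lam u) (lam v) <= s2 + s2.
  move=> /dropP uv.
  have hu := half u v uv u (or_introl erefl).
  have hv := half u v uv v (or_intror erefl); rewrite dist_sym in hv.
  by have := dist_triangle (lam u) (mu (lam u) (lam v) (lam (f x))) (lam v); lra.
pose P1 := {p : cube k | p \in codom drop}.
pose r1 u : P1 := Sub (drop u) (codom_f drop u).
pose g (p : P1) : P := iinv (valP p).
have gK (p : P1) : drop (g p) = val p by exact: f_iinv.
pose m1 (p q t : P1) : P1 := r1 (m (g p) (g q) (g t)).
have m1M (p q t : P1) : val (m1 p q t) = mu_cube (val p) (val q) (val t).
  by rewrite -(gK p) -(gK q) -(gK t) /=; apply/ffunP => z; rewrite !ffunE cM !ffunE.
have [|P2 [m2 [r2 [lam2 [med2 [rk2 [q2 close2]]]]]]] :=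
    hL2 P1 m1 val (lam \o g) val_inj m1M.
  move=> p q t /=.
  have := fibre (g (m1 p q t)) (m (g p) (g q) (g t)); rewrite gK => /(_ erefl) h1.
  have := qlam (g p) (g q) (g t).
  have := dist_triangle (lam (g (m1 p q t))) (lam (m (g p) (g q) (g t)))
    (mu (lam (g p)) (lam (g q)) (lam (g t))).
  by rewrite /L1; lra.
exists P2, m2, (r2 \o r1), lam2; split=> //; split=> //.
split=> [p q t|u]; apply: Rle_trans (Rmax_r _ _).
  exact: Rle_trans (q2 _ _ _) (Rmax_l _ _).
apply: Rle_trans (Rmax_r _ _) => /=.
have := fibre (g (r1 u)) u; rewrite gK => /(_ erefl) h1.
by have := dist_triangle (lam2 (r2 (r1 u))) (lam (g (r1 u))) (lam u);
  have := close2 (r1 u); rewrite /=; lra.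
Qed.

(** The ambient cube has dimension depending on [p] alone, so [rank_reduction] gives one constant
    for all lists of length at most [p]. *)
Lemma short_edges_rank (n : nat) (H : nat -> R) :
  C2_with d mu H (fun _ _ => True) -> short_edges n ->
  exists H', C2_with d mu H' (fun P m => median_rank_le m n).
Proof.
move=> hC2 se.
have step p : exists s, forall A : list X,
    (1 <= length A)%coq_nat -> (length A <= p)%coq_nat ->
    exists (P : finType) (m : P -> P -> P -> P),
      median_algebra m /\ median_rank_le m n /\
      exists (pi : X -> P) (lam : P -> X),
        quasi_hom s m lam /\ (forall a, In a A -> d (lam (pi a)) a <= s).
  have [L hL] := rank_reduction #|{: cube p}| (H p) se.
  exists (Rmax L (L + H p)) => A A1 Ap.
  have [P [m [medP [_ [pi [lam [qlam lampi]]]]]]] := hC2 p A A1 Ap.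
  case: A A1 Ap lampi => [/leP//|a0 A'] _; set A := a0 :: A' => Ap lampi.
  have p_gt0 : (0 < p)%N by move/leP: Ap; apply: leq_trans.
  (* A list shorter than [p] is padded with its head [a0]. *)
  pose v (i : 'I_p) := pi (List.nth i A a0).
  have [T [mT [c [g [t [c_inj [cM [gM gt]]]]]]]] := cube_model_of_points v medP.
  have [|P' [m' [r [lam' [med' [rk' [q' close']]]]]]] :=
    hL T mT c (lam \o g) c_inj cM.
    by move=> x y z; rewrite /= gM; apply: qlam.
  (* Each listed point gets one of its positions; any other point goes to index 0, available since
     [p] is positive. *)
  have index a : exists u : P', In a A -> d (lam' u) a <= L + H p.
    case: (classic (In a A)) => [aA|naA]; last first.
      by exists (r (t (Ordinal p_gt0))).
    have [k [/ltP kA ka]] := In_nth A a a0 aA.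
    have kp : (k < p)%N by apply: leq_trans kA _; apply/leP.
    exists (r (t (Ordinal kp))) => _.
    have := close' (t (Ordinal kp)); rewrite /= gt /v [nat_of_ord _]/= ka.
    have := lampi a aA; rewrite /close.
    by have := dist_triangle (lam' (r (t (Ordinal kp)))) (lam (pi a)) a; lra.
  have [pi' hpi'] := functional_choice _ index.
  exists P', m'; split=> //; split=> //; exists pi', lam'; split=> [x y z|a aA].
    exact: Rle_trans (q' _ _ _) (Rmax_l _ _).
  exact: Rle_trans (hpi' a aA) (Rmax_r _ _).
have [H' hH'] := functional_choice _ step.
by exists H' => p A A1 Ap; apply: hH'.
Qed.

Lemma quasi_morphism_hom (L : R) (k : nat) (sigma : cube k -> X) :
  quasi_morphism d mu L sigma <-> quasi_hom L (@mu_cube k) sigma.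
Proof. by split=> h x y z; have := h x y z; rewrite /close dist_sym. Qed.

End Coarse.

(** * Equivalence of the three conditions *)

Theorem theorem4p11 (X : Type) (d : X -> X -> R) (mu : X -> X -> X -> X) (n : nat) :
  coarse_median_space d mu ->
  (rank_at_most d mu n <->
   (forall lam : R, 0 < lam -> exists C : R,
      forall (a b : X) (e : 'I_n.+1 -> X),
        (forall i, in_interval mu a b (e i)) ->
        (forall i j, i <> j -> close d lam (mu (e i) a (e j)) a) ->
        exists i, close d C (e i) a)) /\
  ((forall lam : R, 0 < lam -> exists C : R,
      forall (a b : X) (e : 'I_n.+1 -> X),
        (forall i, in_interval mu a b (e i)) ->
        (forall i j, i <> j -> close d lam (mu (e i) a (e j)) a) ->
        exists i, close d C (e i) a) <->
   (forall L : R, 0 < L -> exists C : R,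
      forall sigma : cube n.+1 -> X,
        quasi_morphism d mu L sigma ->
        exists x y, adjacent x y /\ close d C (sigma x) (sigma y))).
Proof.
move=> [metric_d [mu_M1 [mu_M2 [[K1 [H1 /(C1_nonneg metric_d)[K [H0 [K_ge0 [H0_ge0 mu_C1]]]]]]
  [H hC2]]]]].
set stmt2 := (forall lam, _); set stmt3 := (forall L, _).
have iff3 : stmt3 <-> short_edges d mu n.
  split=> h L L0; have [C hC] := h L L0; exists C => sigma /(quasi_morphism_hom mu metric_d) hs.
    by apply: hC; apply: hs.
  by apply: hC; apply: hs.
(* Distinct vertices need not be adjacent here: [short_edge_at_zero] asks only for a coordinate
   where they differ. *)
have cube_edge C L s (P : Type) (m : P -> P -> P -> P) lam (f : cube n.+1 -> P) a e x y :
    quasi_hom d mu L m lam -> cube_hom m f -> x <> y ->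
    d (lam (f x)) (lam (f y)) <= C -> d (lam (f (zero_vertex _))) a <= s ->
    (forall i, d (lam (f (unit_vertex i))) (e i) <= s) ->
    exists i, d (e i) a <= L + (K * (0 + C + 0) + H0) + L + 2 * s.
  move=> ql fM xy Cxy f0 fu.
  have [i xyi] := cube_neq xy.
  exists i.
  have := short_edge_at_zero metric_d K_ge0 mu_C1 (quasi_morphism_of_hom ql fM) xyi Cxy.
  rewrite /=; have := fu i; rewrite dist_sym //.
  have := dist_triangle metric_d (e i) (lam (f (unit_vertex i))) a.
  have := dist_triangle metric_d (lam (f (unit_vertex i))) (lam (f (zero_vertex _))) a.
  lra.
have imp12 : rank_at_most d mu n -> stmt2.
  move=> [_ [_ [H' [_ hC2']]]] s0 _.
  have [s hs] := interval_cube metric_d K_ge0 mu_C1 mu_M1 mu_M2 n.+1 s0 hC2'.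
  (* The index [n.+3] counts [a], [b] and [n.+1] further points; the edge length is 0 because [f]
     identifies two vertices. *)
  exists (H' n.+3 + (K * (0 + 0 + 0) + H0) + H' n.+3 + 2 * s) => a b e eI eM.
  have [P [m [lam [f [rk [ql [fM [f0 fu]]]]]]]] := hs a b e eI eM.
  have [x [y [xy fxy]]] : exists x y, x <> y /\ f x = f y.
    apply: NNPP => noxy; have := rk n.+1; rewrite ltnn => /(_ _)/negP; apply=> //.
    exists f; split=> // x y fxy; apply: NNPP => xy; apply: noxy; by exists x, y.
  apply: (cube_edge _ _ _ _ _ _ _ _ _ x y ql fM xy _ f0 fu).
  by rewrite fxy dist_refl //; lra.
have imp32 : stmt3 -> stmt2.
  move=> /iff3 se s0 _.
  have [s hs] := interval_cube metric_d K_ge0 mu_C1 mu_M1 mu_M2 n.+1 s0 hC2.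
  pose L := Rmax (H n.+3) 1.
  have L_gt0 : 0 < L by apply: Rlt_le_trans (Rmax_r _ _); lra.
  have [C hC] := se _ L_gt0.
  exists (L + (K * (0 + C + 0) + H0) + L + 2 * s) => a b e eI eM.
  have [P [m [lam [f [_ [ql [fM [f0 fu]]]]]]]] := hs a b e eI eM.
  have {}ql : quasi_hom d mu L m lam.
    by move=> x y z; apply: Rle_trans (ql _ _ _) (Rmax_l _ _).
  have [x [y [xy Cxy]]] := hC _ (quasi_morphism_of_hom ql fM).
  exact: (cube_edge _ _ _ _ _ _ _ _ _ x y ql fM (adjacent_neq xy) Cxy f0 fu).
have imp23 : stmt2 -> stmt3.
  move=> h2; apply/iff3 => L L0.
  have s0_gt0 : 0 < L + (K * (L + 0 + L) + H0).
    have : 0 <= K * (L + 0 + L) by apply: Rmult_le_pos; lra.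
    by lra.
  have [C hC] := h2 _ s0_gt0.
  exists (L + C) => sigma qs.
  set o := zero_vertex n.+1; pose t : cube n.+1 := [ffun=> true].
  (* Images of neighbours of [o] are moved into the interval; the cost is at most [L], as each
     neighbour lies between [o] and [t]. *)
  pose e i := mu (sigma o) (sigma (unit_vertex i)) (sigma t).
  have eu i : d (sigma (unit_vertex i)) (e i) <= L.
    have uE : unit_vertex i = mu_cube o (unit_vertex i) t.
      by apply/ffunP => j; rewrite !ffunE; case: (i == j).
    by rewrite {1}uE; apply: qs.
  have [i|i j ij|i Ci] := hC (sigma o) (sigma t) e.
  - by exists (sigma (unit_vertex i)).
  - rewrite /close dist_sym //.
    have oE : o = mu_cube (unit_vertex i) o (unit_vertex j).
      apply/ffunP => k; rewrite !ffunE; case: (i =P k) => [<-|_] //.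
      by case: (j =P i) => // ji; case: ij.
    rewrite {1}oE; apply: (mu_closeL metric_d K_ge0 mu_C1 (qs _ _ _)) => //.
    by rewrite dist_refl //; lra.
  exists (unit_vertex i), o; split.
    rewrite /adjacent; suff -> : [set j | unit_vertex i j != o j] = [set i].
      exact: cards1.
    by apply/setP => j; rewrite !inE !ffunE (eq_sym j); case: (i == j).
  by have := dist_triangle metric_d (sigma (unit_vertex i)) (e i) (sigma o);
    have := eu i; move: Ci; rewrite /close; lra.
have imp31 : stmt3 -> rank_at_most d mu n.
  move=> /iff3 se; exists K, H0.
  have [H' hH'] := short_edges_rank metric_d K_ge0 mu_C1 mu_M1 hC2 se.
  by exists H'.
split; split=> //; by [move/imp23/imp31 | exact: imp12].
Qed.
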